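(* For a permutation $w\in\mathfrak{S}_n$ the following are equivalent: (i) $\#\mathrm{reg}(w)=\#[e,w]$; (ii) $w$ has the right hull property, i.e. $[e,w]=\{u\in\mathfrak{S}_n:\mathrm{diag}(u)\subseteq\mathrm{rh}(w)\}$; (iii) $w$ avoids the patterns $4231$, $35142$, $42513$ and $351624$; (iv) $\mathrm{al}(u,w)=\ell'(uw^{-1})$ for all $u\le w$.
   Context: Permutations are composed left to right: $uw(i)=w(u(i))$. $\mathfrak{S}_n$ is a Coxeter group with simple reflections the adjacent transpositions; $T$ = set of transpositions, $\ell$ = Coxeter length (number of inversions), $\ell'(x)=n-c(x)$ with $c(x)$ the number of cycles of $x$. The Bruhat graph has directed edges $x\to tx$ for transpositions $t$ with $\ell(x)<\ell(tx)$; Bruhat order $\le$ is its transitive closure, $[e,w]=\{u:u\le w\}$, and $\mathrm{al}(u,w)$ is the directed distance from $u$ to $w$ in the Bruhat graph. $\mathrm{reg}(w)$ is the set of connected components of the complement in $\mathbb{R}^n$ of the union of the hyperplanes $\{x_i=x_j\}$ over all $1\le i<j\le n$ with $w(i)>w(j)$. $\mathrm{diag}(x)=\{(i,x(i)):i\in[n]\}$; $\mathrm{rh}(w)$ is the set of $(i,j)\in[n]^2$ such that both $\{(a,b):a\le i,\,b\ge j\}$ and $\{(a,b):a\ge i,\,b\le j\}$ meet $\mathrm{diag}(w)$. A permutation $w\in\mathfrak{S}_n$ contains $p\in\mathfrak{S}_m$ if there are indices $i_1<\cdots<i_m$ with $p(j)<p(k)\iff w(i_j)<w(i_k)$ for all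 $j<k$; otherwise $w$ avoids $p$ (patterns written in one-line notation). *)

(* Defs.v *)
From HB Require Import structures.
From mathcomp Require Import all_boot all_order all_algebra all_fingroup.
From mathcomp Require Import boolp classical_sets cardinality reals.
From mathcomp Require Import topology normedtype.

Set Implicit Arguments.
Unset Strict Implicit.
Unset Printing Implicit Defensive.

Import numFieldNormedType.Exports.

(* [n] is represented by 'I_n, i.e. all positions and values are shifted down
   by one.  The product of 'S_n is already the left-to-right one:
   permM : (u * w) i = w (u i). *)

Section Distance.
Variables (T : finType) (e : rel T).

Definition has_path_of_length (x y : T) (k : nat) : bool :=
  [exists p : k.-tuple T, path e x p && (last x p == y)].

(* A shortest path visits each vertex at most once, so its length is < #|T|;
   the junk value is #|T| when y is not reachable from x. *)
Definition directed_distance (x y : T) : nat :=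
  find (has_path_of_length x y) (iota 0 #|T|).

Lemma has_path_of_lengthP x y k :
  reflect (exists p : seq T, [/\ size p = k, path e x p & last x p = y])
          (has_path_of_length x y k).
Proof.
apply: (iffP existsP) => [[p /andP[xp /eqP py]]|[p [sp xp py]]].
  by exists p; rewrite size_tuple.
by have /eqP tp := sp; exists (Tuple tp); rewrite xp py eqxx.
Qed.

Lemma directed_distance_min x y (p : seq T) :
  path e x p -> last x p = y -> directed_distance x y <= size p.
Proof.
move=> xp py; rewrite leqNgt; apply/negP => lt_p.
have lt_pT : size p < #|T|.
  by rewrite (leq_trans lt_p)// -[leqRHS](size_iota 0) find_size.
have := before_find 0 lt_p; rewrite nth_iota// add0n.
by move/has_path_of_lengthP; apply; exists p.
Qed.

Lemma directed_distance_path x y : connect e x y ->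
  exists p : seq T,
    [/\ size p = directed_distance x y, path e x p & last x p = y].
Proof.
move/connectP => [p0 xp0 ->].
have [p xp up _] := shortenP xp0.
apply/has_path_of_lengthP.
have lt_pT : size p < #|T|.
  by rewrite -[(size p).+1]/(size (x :: p)) -(card_uniqP up) max_card.
have hp : has (has_path_of_length x (last x p)) (iota 0 #|T|).
  apply/hasP; exists (size p); first by rewrite mem_iota.
  by apply/has_path_of_lengthP; exists p.
have := nth_find 0 hp; rewrite nth_iota ?add0n//.
by rewrite -[ltnRHS](size_iota 0) -has_find.
Qed.

End Distance.

Section Permutations.
Variable n : nat.
Implicit Types (t u w x y : 'S_n).

Definition is_transposition t : bool :=
  [exists i : 'I_n, exists j : 'I_n, (i != j) && (t == tperm i j)].

Definition coxeter_length x : nat :=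
  #|[set p : 'I_n * 'I_n | (p.1 < p.2) && (x p.2 < x p.1)]|.

(* porbits x contains the trivial cycles. *)
Definition absolute_length x : nat := n - #|porbits x|.

Definition bruhat_edge : rel 'S_n := fun x y =>
  [exists t : 'S_n, [&& is_transposition t, y == (t * x)%g
                      & coxeter_length x < coxeter_length y]].

Definition bruhat_le : rel 'S_n := connect bruhat_edge.

Definition lower_interval w : {set 'S_n} := [set u | bruhat_le u w].

Definition al u w : nat := directed_distance bruhat_edge u w.

Definition diag x : {set 'I_n * 'I_n} := [set (i, x i) | i : 'I_n].

Definition right_hull w : {set 'I_n * 'I_n} :=
  [set c : 'I_n * 'I_n |
     ~~ [disjoint [set d : 'I_n * 'I_n | (d.1 <= c.1) && (d.2 >= c.2)]
                & diag w]
  && ~~ [disjoint [set d : 'I_n * 'I_n | (d.1 >= c.1) && (d.2 <= c.2)]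
                & diag w]].

Definition right_hull_property w : Prop :=
  lower_interval w = [set u : 'S_n | diag u \subset right_hull w].

Definition contains_pattern (m : nat) w (p : 'S_m) : Prop :=
  exists f : 'I_m -> 'I_n,
    (forall j k : 'I_m, j < k -> f j < f k) /\
    (forall j k : 'I_m, j < k -> (p j < p k <-> w (f j) < w (f k))).

Definition avoids_pattern (m : nat) w (p : 'S_m) : Prop :=
  ~ contains_pattern w p.

End Permutations.

Section OneLine.
Variables (m : nat) (s : seq nat).
Hypothesis s_perm : perm_eq s (iota 1 m).

Let one_line_fun (i : 'I_m) : 'I_m := insubd i (nth 0 s i).-1.

Let size_s : size s = m.
Proof. by rewrite (perm_size s_perm) size_iota. Qed.

Let nth_bounds (i : 'I_m) : 0 < nth 0 s i <= m.
Proof.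
have : nth 0 s i \in s by rewrite mem_nth// size_s.
by rewrite (perm_mem s_perm) mem_iota add1n ltnS.
Qed.

Let val_one_line_fun i : one_line_fun i = (nth 0 s i).-1 :> nat.
Proof.
have /andP[s_gt0 s_le] := nth_bounds i.
by rewrite val_insubd prednK// s_le.
Qed.

Lemma one_line_inj : injective one_line_fun.
Proof.
move=> i j /(congr1 val); rewrite /= !val_one_line_fun => /(congr1 S).
have /andP[si _] := nth_bounds i; have /andP[sj _] := nth_bounds j.
rewrite !prednK// => /eqP.
rewrite nth_uniq ?size_s// ?(perm_uniq s_perm) ?iota_uniq// => /eqP.
exact: val_inj.
Qed.

Definition one_line : 'S_m := perm one_line_inj.

Lemma one_lineE (i : 'I_m) : (one_line i).+1 = nth 0 s i.
Proof.
rewrite permE val_one_line_fun prednK//.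
by have /andP[] := nth_bounds i.
Qed.

End OneLine.

Definition p4231 : 'S_4 := @one_line 4 [:: 4; 2; 3; 1] isT.
Definition p35142 : 'S_5 := @one_line 5 [:: 3; 5; 1; 4; 2] isT.
Definition p42513 : 'S_5 := @one_line 5 [:: 4; 2; 5; 1; 3] isT.
Definition p351624 : 'S_6 := @one_line 6 [:: 3; 5; 1; 6; 2; 4] isT.

Section Regions.
Variables (R : realType) (n : nat).
Local Open Scope classical_set_scope.

Definition hyperplane (i j : 'I_n) : set 'rV[R]_n :=
  [set x | x ord0 i = x ord0 j].

Definition arrangement_complement (w : 'S_n) : set 'rV[R]_n :=
  ~` \bigcup_(p in [set p : 'I_n * 'I_n | (p.1 < p.2)%N /\ (w p.1 > w p.2)%N])
       hyperplane p.1 p.2.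

Definition reg (w : 'S_n) : set (set 'rV[R]_n) :=
  [set connected_component (arrangement_complement w) x
     | x in arrangement_complement w].

End Regions.

Arguments hyperplane R {n} i j.
Arguments arrangement_complement R {n} w.
Arguments reg R {n} w.

(* Main.v *)
(** The regions of the inversion arrangement of [w] are counted by the
    no-broken-circuit (NBC) sets of the inversion graph, the edges [(a, b)] being
    ordered by [b - a].  Multiplying the transpositions of an NBC set, shortest
    first, yields a permutation [p] from whose cycles the set can be read off:
    its first edge is the shortest inversion inside a cycle.  That edge joins two
    neighbours of a cycle, so it acts as a simple reflection on the parabolic
    subgroup of the cycles, and lifting gives an ascending path of length [l'(p)]
    from [p w] to [w].  With D the set of these products this gives
    #reg(w) = #D and D w <= [e, w] <= {u : diag(u) in rh(w)}.

    If [w] avoids the four patterns and [diag(u)] lies in [rh(w)], then each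
    nontrivial cycle of [u w^-1] contains an inversion of [w], and splitting it
    at an inversion between neighbours stays in the right hull; hence
    [u w^-1] is in D, and all the inclusions are equalities.

    Conversely, each pattern carries a cycle on part of its positions that stays
    in the right hull but leaves the Bruhat interval, because one entry of the
    rank matrix restricted to these positions grows.  A second, disjoint
    transposition brings the permutation back below [w], but a path of length
    [l'(u w^-1)] only uses transpositions within the cycles of [u w^-1], along
    which the restricted rank is monotone, so [al(u, w)] is larger. *)

Require Import Defs.
From mathcomp Require Import all_boot all_order all_algebra all_fingroup.
From mathcomp Require Import boolp classical_sets cardinality reals.
From mathcomp Require Import topology normedtype.
From mathcomp Require Import zify ring lra.

Set Implicit Arguments.
Unset Strict Implicit.
Unset Printing Implicit Defensive.

Import Order.TTheory GRing.Theory Num.Theory.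
Import numFieldNormedType.Exports.

Local Notation swap e := (tperm e.1 e.2).
Local Notation linked p e := (e.1 \in porbit p e.2).

(** * Cycles of a permutation multiplied by a transposition *)

Section Cycles.
Variable T : finType.
Implicit Types (p : {perm T}) (a b c d : T).

Lemma porbit_invariant (A : Type) (f : T -> A) p :
  (forall i, f (p i) = f i) -> forall c d, c \in porbit p d -> f c = f d.
Proof.
move=> fp c d /porbitP[k ->]; elim: k => [|k IHk]; first by rewrite expg0 perm1.
by rewrite expgSr permM fp.
Qed.

Lemma porbit_trans p c d e :
  c \in porbit p d -> d \in porbit p e -> c \in porbit p e.
Proof. by rewrite -!eq_porbit_mem => /eqP-> /eqP->. Qed.

Lemma mem_porbit_perm p c d : (p c \in porbit p d) = (c \in porbit p d).
Proof. by rewrite -!eq_porbit_mem -[p c]/((p ^+ 1)%g c) porbit_perm. Qed.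

Lemma porbit_tperm p a b c d :
  a \in porbit p b -> c \in porbit p d -> tperm a b c \in porbit p d.
Proof.
move=> ab cd; case: tpermP => [E|E|] //; subst c; last exact: porbit_trans cd.
by apply: porbit_trans cd; rewrite porbit_sym.
Qed.

Lemma porbit_split p a b c d : a \in porbit p b ->
  c \in porbit (tperm a b * p)%g d -> c \in porbit p d.
Proof.
move=> ab /(porbit_invariant (f := fun i => i \in porbit p d)) ->.
  exact: porbit_id.
move=> i; rewrite permM mem_porbit_perm; apply/idP/idP; last exact: porbit_tperm.
by move/(porbit_tperm ab); rewrite tpermK.
Qed.

(** Multiplying twice by the transposition gives [p] back, so adding the two cycle counts from
    [porbits_mul_tperm] leaves exactly one of [p] and [tperm a b * p] with [a] and [b] in a common
    cycle. *)
Lemma porbit_mul_tperm p a b : a != b ->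
  (a \in porbit (tperm a b * p)%g b) = (a \notin porbit p b).
Proof.
move=> ab; have := porbits_mul_tperm p a b.
have := porbits_mul_tperm (tperm a b * p) a b.
rewrite /= mulgA tperm2 mul1g ab.
by case: (a \in _); case: (a \in _) => //=; lia.
Qed.

Lemma porbit_join p a b c d : a != b -> a \notin porbit p b ->
  c \in porbit p d -> c \in porbit (tperm a b * p)%g d.
Proof.
move=> ab nab cd; apply: (@porbit_split _ a b).
  by rewrite porbit_mul_tperm.
by rewrite mulgA tperm2 mul1g.
Qed.

End Cycles.

(** * Absolute length, Coxeter length and edges of the Bruhat graph *)

Section Bruhat.
Variable n : nat.
Implicit Types (u w x y p q : 'S_n) (a b c d i j : 'I_n) (e f g : 'I_n * 'I_n).

Lemma card_porbits_le p : #|porbits p| <= n.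
Proof. by apply: leq_trans (leq_imset_card _ _) _; rewrite card_ord. Qed.

Lemma absolute_length1 : absolute_length (1 : 'S_n) = 0.
Proof.
rewrite /absolute_length card_imset ?card_ord ?subnn// => i j ij.
have /porbitP[k ->] : i \in porbit 1 j by rewrite -ij porbit_id.
by rewrite expg1n perm1.
Qed.

Lemma absolute_length_join p a b : a != b -> a \notin porbit p b ->
  absolute_length (tperm a b * p)%g = (absolute_length p).+1.
Proof.
move=> ab nab; have := porbits_mul_tperm p a b; rewrite /= ab nab => H.
have aux k1 k2 : k1 + true.*2 = k2 + true -> k2 <= n -> n - k1 = (n - k2).+1.
  by rewrite /=; lia.
exact: aux H (card_porbits_le p).
Qed.

Lemma absolute_length_split p a b : a != b -> a \in porbit p b ->
  (absolute_length (tperm a b * p)%g).+1 = absolute_length p.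
Proof.
move=> ab lab; rewrite -(@absolute_length_join (tperm a b * p)%g a b) ?mulgA ?tperm2 ?mul1g//.
by rewrite porbit_mul_tperm ?lab.
Qed.

Lemma absolute_length_tperm p a b :
  absolute_length p <= (absolute_length (tperm a b * p)%g).+1.
Proof.
have [->|ab] := eqVneq a b; first by rewrite tperm1 mul1g; lia.
have [lab|nab] := boolP (a \in porbit p b).
  by rewrite -(absolute_length_split ab lab).
by rewrite absolute_length_join//; lia.
Qed.

(** The map [phi] injects the inversions of [x] into those of the product other than [(c, d)]: it
    moves both positions by [s], unless this reverses their order, in which case it keeps the
    pair. *)
Lemma coxeter_length_tperm x c d : c < d -> x c < x d ->
  coxeter_length x < coxeter_length (tperm c d * x)%g.
Proof.
move=> cd xcd; set s := tperm c d.
pose phi (q : 'I_n * 'I_n) := if s q.1 < s q.2 then (s q.1, s q.2) else q.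
rewrite /coxeter_length.
set A := [set q : 'I_n * 'I_n | _]; set B := [set q : 'I_n * 'I_n | _].
have ncd i j : i < j -> s j < s i -> [\/ i = c /\ j = d,
    [/\ i = c, c < j & j < d] | [/\ j = d, c < i & i < d]].
  rewrite /s; case: tpermP => [->|->|/eqP jc /eqP jd];
    case: tpermP => [->|->|/eqP ic /eqP id]; try by move=> *; lia.
  - by move=> _ _; apply: Or31.
  - by move=> ? ?; apply: Or33.
  - by move=> ? ?; apply: Or32.
have sE i j : i < j -> ~~ (s i < s j) -> s j < s i.
  move=> ij; rewrite -leqNgt leq_eqVlt => /orP[/eqP/val_inj/perm_inj|//].
  by move=> ji; move: ij; rewrite ji ltnn.
have phiB (q : 'I_n * 'I_n) : q \in A -> phi q \in B :\ (c, d).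
  rewrite !inE /phi => /andP[lt_q xq]; case: ifPn => [sq|/sE-/(_ lt_q) sq] /=.
    rewrite !permM -/s !tpermK sq xq !andbT /=; apply/eqP => -[E1 E2].
    by move: lt_q; rewrite -(tpermK c d q.1) -(tpermK c d q.2) -/s E1 E2;
       rewrite tpermL tpermR; lia.
  rewrite !permM -/s lt_q.
  have [[E1 E2]|[E1 l1 l2]|[E2 l1 l2]] := ncd _ _ lt_q sq; move: xq.
  - by rewrite E1 E2; lia.
  - move=> xq; have -> : s q.2 = q.2 by rewrite /s tpermD// -val_eqE /=; lia.
    rewrite -pair_eqE /= E1 /s tpermL; rewrite E1 in xq.
    by rewrite (ltn_trans xq)// andbT -!val_eqE /=; lia.
  - move=> xq; have -> : s q.1 = q.1 by rewrite /s tpermD// -val_eqE /=; lia.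
    rewrite -pair_eqE /= E2 /s tpermR; rewrite E2 in xq.
    by rewrite (ltn_trans xcd)// andbT -!val_eqE /=; lia.
have phi_inj : {in A &, injective phi}.
  move=> q r; rewrite !inE => /andP[q1 _] /andP[r1 _]; rewrite /phi.
  case: ifPn => sq; case: ifPn => sr.
  - by case: q r {q1 r1 sq sr} => [q1 q2] [r1 r2] /= [/perm_inj-> /perm_inj->].
  - by move=> E; move: sr; rewrite -E /= !tpermK q1.
  - by move=> E; move: sq; rewrite E /= !tpermK r1.
  - by [].
rewrite -(card_in_imset phi_inj) (cardsD1 (c, d) B).
have -> : (c, d) \in B by rewrite !inE /= !permM tpermL tpermR cd.
rewrite add1n ltnS; apply/subset_leq_card/fintype.subsetP => _ /imsetP[q qA ->].
exact: phiB.
Qed.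

(** If instead the values at the two positions were inverted in [x], then [coxeter_length_tperm]
    applied to the product would make the length drop. *)
Lemma bruhat_edgeP x y :
  reflect (exists c d, [/\ c < d, x c < x d & y = (tperm c d * x)%g])
          (bruhat_edge x y).
Proof.
apply: (iffP existsP) => [[t /and3P[/existsP[i /existsP[j]]]]|[c [d [cd xcd ->]]]].
  wlog ij : i j / i < j.
    move=> wl ij; have /andP[] := ij.
    rewrite -val_eqE neq_ltn => /orP[|] lt_ij _; first exact: wl ij.
    by move: ij; rewrite eq_sym tpermC; apply: wl.
  move=> /andP[_ /eqP->] /eqP-> lt_l; exists i, j; split=> //.
  rewrite ltnNge leq_eqVlt; apply/negP => /orP[/eqP/val_inj/perm_inj E|ji].
    by move: ij; rewrite E ltnn.
  have := @coxeter_length_tperm (tperm i j * x)%g i j ij.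
  rewrite !permM tpermL tpermR mulgA tperm2 mul1g => /(_ ji).
  by move/(ltn_trans lt_l); rewrite ltnn.
exists (tperm c d); apply/and3P; split=> //; last exact: coxeter_length_tperm.
by apply/existsP; exists c; apply/existsP; exists d; rewrite eqxx -val_eqE /=; lia.
Qed.

Lemma absolute_length_path x w (s : seq 'S_n) :
  path (@bruhat_edge n) x s -> last x s = w ->
  absolute_length (x * w^-1)%g <= size s.
Proof.
elim: s x => [|y s IHs] x /= => [_ ->|/andP[/bruhat_edgeP[c [d [_ _ y_def]]] yP yw]].
  by rewrite mulgV absolute_length1.
apply: leq_trans (absolute_length_tperm _ c d) _.
by rewrite mulgA -y_def ltnS; apply: IHs.
Qed.

Lemma absolute_length_le_al u w :
  bruhat_le u w -> absolute_length (u * w^-1)%g <= al u w.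
Proof.
move=> /directed_distance_path[s [sz up uw]]; rewrite /al -sz.
exact: absolute_length_path uw.
Qed.

End Bruhat.

(** * Products of no-broken-circuit sets of inversions *)

Section BrokenCircuits.
Variable n : nat.
Implicit Types (u w x y p q : 'S_n) (e f g : 'I_n * 'I_n).
Implicit Types E F : seq ('I_n * 'I_n).

(* Deletion-contraction on the first edge, which is the largest one: [q] is the
   product of the edges contracted so far, and its cycles are the vertices of
   the contracted graph, in which a linked edge is a loop. *)
Fixpoint nbc F q : seq 'S_n :=
  if F is e :: F' then
    if linked q e then [::] else nbc F' q ++ nbc F' (swap e * q)%g
  else [:: q].

(** Here [g] is smaller than all edges used in [p]. If [p] links its ends, then [g] closes a circuit
    with some of them, which form a broken circuit, so [p] itself is discarded. *)
Definition nbc_step g p : seq 'S_n :=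
  if linked p g then [::] else [:: p; (swap g * p)%g].

Lemma nbc_rcons F g q : nbc (rcons F g) q = flatten [seq nbc_step g p | p <- nbc F q].
Proof.
elim: F q => [|e F IHF] q /=; first by rewrite /nbc_step; case: ifP.
by case: ifP => //= _; rewrite !IHF map_cat flatten_cat.
Qed.

(** Multiplication by [swap g] toggles whether [g] is linked, so the product alone tells whether [g]
    was chosen. *)
Lemma mem_nbc_step g (L : seq 'S_n) p : g.1 != g.2 ->
  (p \in flatten [seq nbc_step g r | r <- L])
  = ((if linked p g then (swap g * p)%g else p) \in L).
Proof.
move=> g12; elim: L => [|r L IHL] /=; first by rewrite in_nil.
rewrite mem_cat IHL inE; congr orb; rewrite /nbc_step.
case: ifPn => rg; case: ifPn => pg.
- rewrite in_nil; apply/esym/eqP => E; move: rg; rewrite -E porbit_mul_tperm//.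
  by rewrite pg.
- by rewrite in_nil; apply/esym/eqP => E; rewrite E rg in pg.
- rewrite !inE; have -> : (p == r) = false.
    by apply/eqP => E; rewrite -E pg in rg.
  by apply/eqP/eqP => [->|<-]; rewrite mulgA tperm2 mul1g.
- rewrite !inE orbC; have -> // : (p == swap g * r)%g = false.
  by apply/eqP => E; rewrite E porbit_mul_tperm// rg in pg.
Qed.

Lemma uniq_nbc_step g (L : seq 'S_n) : g.1 != g.2 -> uniq L ->
  uniq (flatten [seq nbc_step g p | p <- L]).
Proof.
move=> g12; elim: L => //= r L IHL /andP[rL uL]; rewrite cat_uniq IHL// andbT.
rewrite {1}/nbc_step; apply/andP; split.
  case: ifPn => //= rg; rewrite andbT inE; apply/eqP => E.
  by have := porbit_mul_tperm r g12; rewrite -E rg (negPf rg).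
apply/hasPn => p; rewrite mem_nbc_step// /nbc_step.
case: ifPn => pg; case: ifPn => rg //=; rewrite ?inE ?mulgA.
  move=> pL; apply/negP => /orP[/eqP E|/eqP E].
    by rewrite -E pg in rg.
  by move: pL; rewrite E mulgA tperm2 mul1g (negPf rL).
move=> pL; apply/negP => /orP[/eqP E|/eqP E].
  by rewrite -E pL in rL.
by rewrite E porbit_mul_tperm// rg in pg.
Qed.

Definition nbc_products E := nbc (rev E) 1%g.

Lemma mem_nbc_products g E p : g.1 != g.2 ->
  (p \in nbc_products (g :: E))
  = ((if linked p g then (swap g * p)%g else p) \in nbc_products E).
Proof. by move=> g12; rewrite /nbc_products rev_cons nbc_rcons mem_nbc_step. Qed.

Lemma uniq_nbc_products E : all (fun e => e.1 != e.2) E -> uniq (nbc_products E).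
Proof.
elim: E => //= g E IHE /andP[g12 /IHE uE].
by rewrite /nbc_products rev_cons nbc_rcons uniq_nbc_step.
Qed.

Definition edge_length e : nat := e.2 - e.1.

Definition inversions w : seq ('I_n * 'I_n) :=
  sort (relpre edge_length leq)
    [seq e : 'I_n * 'I_n <- enum {: 'I_n * 'I_n} | (e.1 < e.2) && (w e.2 < w e.1)].

Lemma mem_inversions w e : (e \in inversions w) = (e.1 < e.2) && (w e.2 < w e.1).
Proof. by rewrite mem_sort mem_filter mem_enum andbT. Qed.

Lemma sorted_inversions w : sorted (relpre edge_length leq) (inversions w).
Proof. by apply: sort_sorted => e f /=; apply: leq_total. Qed.

Lemma inversions_neq w : all (fun e => e.1 != e.2) (inversions w).
Proof.
by apply/allP => e; rewrite mem_inversions => /andP[e12 _]; rewrite -val_eqE neq_ltn e12.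
Qed.

(** Induction over the suffixes of the sorted list. Ties in length are harmless, because only
    strictly shorter edges have to be absent. *)
Lemma inversions_ind w (P : seq ('I_n * 'I_n) -> Prop) :
  P [::] ->
  (forall g E, g.1 < g.2 -> w g.2 < w g.1 ->
     (forall f, edge_length f < edge_length g -> f \notin g :: E) ->
     P E -> P (g :: E)) ->
  P (inversions w).
Proof.
move=> P0 PS.
suff H E : sorted (relpre edge_length leq) E -> {subset E <= inversions w} -> P E.
  by apply: H (sorted_inversions w) _.
elim: E => // g E IHE /=; rewrite path_sortedE; last first.
  by move=> ? ? ? /=; apply: leq_trans.
move=> /andP[/allP gE sE] sub; have := sub _ (mem_head _ _).
rewrite mem_inversions => /andP[g12 wg]; apply: PS => //.
- move=> f fg; rewrite inE negb_or; apply/andP; split.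
    by apply/eqP => fE; rewrite fE ltnn in fg.
  by apply/negP => /gE /=; lia.
- by apply: IHE => // f fE; apply: sub; rewrite inE fE orbT.
Qed.

(** For a point [c] of the cycle strictly between the ends, [(g.1, c)] or [(c, g.2)] would be a
    shorter linked inversion, according to the value at [c]. *)
Lemma shortest_linked_adjacent w g p :
  w g.2 < w g.1 -> linked p g ->
  (forall f, f \in inversions w -> edge_length f < edge_length g -> ~~ linked p f) ->
  forall c, c \in porbit p g.2 -> ~~ (g.1 < c < g.2).
Proof.
move=> wg pg unl c pc; apply/negP => /andP[g1c cg2].
have [wc|wc] := ltnP (w c) (w g.1).
  have := unl (g.1, c); rewrite mem_inversions /= g1c wc => /(_ isT).
  rewrite (porbit_trans pg) 1?porbit_sym// => H.
  by have: false by apply: H; rewrite /edge_length /=; lia.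
have := unl (c, g.2); rewrite mem_inversions /= cg2 (leq_trans wg)// pc => /(_ isT) H.
by have: false by apply: H; rewrite /edge_length /=; lia.
Qed.

End BrokenCircuits.

(** * Ascending paths from NBC products; rank matrices and the right hull *)

Section LowerInterval.
Variable n : nat.
Implicit Types (u w x y p q : 'S_n) (a b c d i j : 'I_n) (e f g : 'I_n * 'I_n).

(** Recording that both positions lie in one cycle of [p] is what allows a whole path to be
    multiplied by a transposition of neighbours in a cycle. *)
Definition cycle_edge p : rel 'S_n := fun x y =>
  [exists c : 'I_n, exists d : 'I_n,
     [&& c < d, x c < x d, y == (tperm c d * x)%g & c \in porbit p d]].

Lemma cycle_edge_bruhat p : subrel (cycle_edge p) (@bruhat_edge n).
Proof.
move=> x y /existsP[c /existsP[d /and4P[cd xcd /eqP yE _]]].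
by apply/bruhat_edgeP; exists c, d.
Qed.

(* The simple reflection [swap g] of the parabolic subgroup attached to the
   cycles of [p] preserves every ascending edge other than its own. *)
Lemma cycle_edge_conj p g x y : g.1 < g.2 -> linked p g ->
  (forall c, c \in porbit p g.2 -> ~~ (g.1 < c < g.2)) ->
  cycle_edge (swap g * p)%g x y -> cycle_edge p (swap g * x)%g (swap g * y)%g.
Proof.
case: g => a b /= ab lab adj /existsP[c /existsP[d /and4P[cd xcd /eqP-> lcd]]].
have neq_ab : a != b by rewrite -val_eqE /= neq_ltn ab.
have pcd := porbit_split lab lcd.
have ncd : (c, d) != (a, b).
  apply/eqP => -[cE dE]; move: lcd; rewrite cE dE porbit_mul_tperm//.
  by rewrite lab.
have pdc : d \in porbit p c by rewrite porbit_sym.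
apply/existsP; exists (tperm a b c); apply/existsP; exists (tperm a b d).
apply/and4P; split.
(* Exchanging [a] and [b] could reverse [c < d] only for the pair [(a, b)] itself, or if one of [c],
   [d] is [a] or [b] and the other lies between them; [ncd] and [adj] exclude both. *)
- move: ncd; rewrite -pair_eqE /= -!val_eqE /=.
  have lba : b \in porbit p a by rewrite porbit_sym.
  case: tpermP => [cE|cE|/eqP + /eqP +]; case: tpermP => [dE|dE|/eqP + /eqP +];
    try subst c; try subst d; rewrite -?val_eqE /=; try by move=> *; lia.
  + by have := adj d (porbit_trans pdc lab); move=> /= *; lia.
  + by have := adj c pcd; move=> /= *; lia.
- by rewrite !permM !tpermK.
- rewrite !mulgA; apply/eqP; congr mulg.
  have := tpermJ c d (tperm a b); rewrite conjgE tpermV => <-.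
  by rewrite -!mulgA tperm2 mulg1.
- rewrite porbit_sym; apply: porbit_tperm => //.
  by rewrite porbit_sym; apply: porbit_tperm.
Qed.

(** If the shortest remaining inversion [g] is linked, the path obtained for [swap g * p] is
    multiplied by [swap g]; it then ends at [swap g * w], and one more ascending edge reaches [w].
    The invariant in [P], that inversions outside [E] are unlinked, makes [g] join neighbours of a
    cycle. *)
Lemma nbc_products_path w p : p \in nbc_products (inversions w) ->
  exists s, [/\ path (cycle_edge p) (p * w)%g s, last (p * w)%g s = w
               & size s = absolute_length p].
Proof.
pose P E := forall p, p \in nbc_products E ->
    (forall f, f \in inversions w -> f \notin E -> ~~ linked p f) ->
  exists s, [/\ path (cycle_edge p) (p * w)%g s, last (p * w)%g s = w
               & size s = absolute_length p].
suff H : P (inversions w) by move=> pin; apply: H => // f ->.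
apply: inversions_ind => {p} /=.
  move=> p; rewrite inE => /eqP-> _; exists [::].
  by rewrite mul1g absolute_length1.
move=> g E g12 wg short IH p.
have neq_g : g.1 != g.2 by rewrite -val_eqE neq_ltn g12.
rewrite mem_nbc_products//; case: ifPn => pg pin unl; last first.
  apply: (IH p pin) => f fw fE; have [->//|fg] := eqVneq f g.
  by apply: unl; rewrite // inE negb_or fg.
have [|s [ps ls sz]] := IH _ pin.
  move=> f fw fE; have [->|fg] := eqVneq f g; first by rewrite porbit_mul_tperm ?pg.
  have := unl f fw; rewrite inE negb_or fg fE => /(_ isT); apply: contra.
  exact: porbit_split.
have adj : forall c, c \in porbit p g.2 -> ~~ (g.1 < c < g.2).
  by apply: (shortest_linked_adjacent wg pg) => f fw /short; apply: unl.
have pE : (p * w = swap g * (swap g * p * w))%g by rewrite !mulgA tperm2 mul1g.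
exists (rcons [seq (swap g * x)%g | x <- s] w).
rewrite last_rcons size_rcons size_map sz -(absolute_length_split neq_g pg).
split=> //; rewrite rcons_path pE; apply/andP; split.
  by apply: homo_path ps => x y; apply: cycle_edge_conj.
rewrite last_map ls; apply/existsP; exists g.1; apply/existsP; exists g.2.
by rewrite g12 pg !permM tpermL tpermR wg mulgA tperm2 mul1g eqxx.
Qed.

Lemma nbc_products_al w p : p \in nbc_products (inversions w) ->
  bruhat_le (p * w)%g w /\ al (p * w)%g w = absolute_length p.
Proof.
move=> /nbc_products_path[s [ps ls sz]].
have bs := sub_path (@cycle_edge_bruhat p) ps.
have le_w : bruhat_le (p * w)%g w by apply/connectP; exists s.
split=> //; apply/eqP; rewrite eqn_leq; apply/andP; split.
  by rewrite -sz; apply: directed_distance_min.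
by have := absolute_length_le_al le_w; rewrite mulgK.
Qed.

(** For [C] full and [P], [Q] half-lines this is an entry of the rank matrix; a smaller [C]
    restricts the count to the positions of some cycles. *)
Definition rank_in (C : {set 'I_n}) (P Q : pred 'I_n) x : nat :=
  \sum_(i in C) (P i && Q (x i)).

(** A rearrangement inequality: the swap brings the value more likely to satisfy [Q] to the position
    more likely to satisfy [P]. *)
Lemma rank_in_tperm (C : {set 'I_n}) (P Q : pred 'I_n) x c d : (c \in C) = (d \in C) ->
  (P d -> P c) -> (Q (x c) -> Q (x d)) ->
  rank_in C P Q x <= rank_in C P Q (tperm c d * x)%g.
Proof.
move=> cdC Pdc Qcd; have [->|cd] := eqVneq c d; first by rewrite tperm1 mul1g.
rewrite /rank_in; have [cC|cC] := boolP (c \in C); last first.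
  apply: leq_sum => i iC; rewrite permM tpermD//.
  - by apply: contraNneq cC => ->.
  - by rewrite cdC in cC; apply: contraNneq cC => ->.
have dC : d \in C by rewrite -cdC.
rewrite (bigD1 c)//= (bigD1 d) /=; last by rewrite dC eq_sym.
rewrite [leqRHS](bigD1 c)//= [in leqRHS](bigD1 d) /=; last by rewrite dC eq_sym.
rewrite !permM tpermL tpermR !addnA; apply: leq_add.
  case: (P d) Pdc => [->//|_]; first by rewrite addnC.
  by rewrite /= !addn0; case: (P c) => //=; case: (Q (x c)) Qcd => // ->.
by apply: leq_sum => i /andP[/andP[_ ic] id]; rewrite permM tpermD // eq_sym.
Qed.

Lemma bruhat_le_rank (P Q : pred 'I_n) u w :
  (forall c d, c < d -> P d -> P c) -> (forall c d, c < d -> Q c -> Q d) ->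
  bruhat_le u w -> rank_in [set: 'I_n] P Q u <= rank_in [set: 'I_n] P Q w.
Proof.
move=> hP hQ /connectP[s us ->]; elim: s u us => //= y s IHs u.
move=> /andP[/bruhat_edgeP[c [d [cd ucd ->]]] /IHs]; apply: leq_trans.
by apply: rank_in_tperm; rewrite ?inE//; [apply: hP|apply: hQ].
Qed.

Lemma bruhat_le_rankC (P Q : pred 'I_n) u w :
  (forall c d, c < d -> P c -> P d) -> (forall c d, c < d -> Q d -> Q c) ->
  bruhat_le u w -> rank_in [set: 'I_n] P Q u <= rank_in [set: 'I_n] P Q w.
Proof.
move=> hP hQ /connectP[s us ->]; elim: s u us => //= y s IHs u.
move=> /andP[/bruhat_edgeP[c [d [cd ucd ->]]] /IHs]; apply: leq_trans.
by rewrite tpermC; apply: rank_in_tperm; rewrite ?inE//; [apply: hP|apply: hQ].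
Qed.

Lemma rank_in_gt0P (C : {set 'I_n}) (P Q : pred 'I_n) x :
  reflect (exists i, [/\ i \in C, P i & Q (x i)]) (0 < rank_in C P Q x).
Proof.
rewrite lt0n /rank_in sum_nat_eq0 negb_forall_in.
apply: (iffP exists_inP) => [[i iC]|[i [iC Pi Qi]]].
  by case Pi: (P i); case Qi: (Q (x i)) => // _; exists i.
by exists i; rewrite // Pi Qi.
Qed.

Lemma right_hullP w i j :
  reflect ((exists2 x : 'I_n, x <= i & j <= w x) /\ (exists2 x : 'I_n, i <= x & w x <= j))
          ((i, j) \in right_hull w).
Proof.
rewrite inE /=; apply: (iffP andP) => [[/pred0Pn[[x y]] + /pred0Pn[[z t]]]|].
  rewrite !inE /= => /andP[/andP[xi jy] /imsetP[x' _ [xE yE]]].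
  move=> /andP[/andP[iz tj] /imsetP[z' _ [zE tE]]]; subst x' y z' t.
  by split; [exists x|exists z].
move=> [[x xi jx] [z iz zj]]; split; apply/pred0Pn.
  by exists (x, w x); rewrite !inE /= xi jx imset_f.
by exists (z, w z); rewrite !inE /= iz zj imset_f.
Qed.

Lemma diag_right_hullP u w :
  reflect (forall i, (exists2 x : 'I_n, x <= i & u i <= w x) /\
                     (exists2 x : 'I_n, i <= x & w x <= u i))
          (diag u \subset right_hull w).
Proof.
apply: (iffP fintype.subsetP) => [H i|H _ /imsetP[i _ ->]].
  by apply/right_hullP/H/imset_f.
by apply/right_hullP/H.
Qed.

(** Both quadrants with corner [(i, u i)] contain a point of [u], so by monotonicity of the ranks
    they contain a point of [w]. *)
Lemma bruhat_le_hull u w : bruhat_le u w -> diag u \subset right_hull w.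
Proof.
move=> le_uw; apply/diag_right_hullP => i; split.
  suff /rank_in_gt0P[x [_ xi ux]] :
      0 < rank_in [set: 'I_n] (fun k => k <= i) (fun k => u i <= k) w by exists x.
  apply: leq_trans (bruhat_le_rank _ _ le_uw); try by move=> c d /=; lia.
  by apply/rank_in_gt0P; exists i; rewrite !leqnn inE.
suff /rank_in_gt0P[x [_ xi ux]] :
    0 < rank_in [set: 'I_n] (fun k => i <= k) (fun k => k <= u i) w by exists x.
apply: leq_trans (bruhat_le_rankC _ _ le_uw); try by move=> c d /=; lia.
by apply/rank_in_gt0P; exists i; rewrite !leqnn inE.
Qed.

End LowerInterval.

(** * Cycles in the right hull of a pattern-avoiding permutation *)

(* Positions and values enter symmetrically under reversal, so they are two
   injective labellings of the same set: [pos i = i] and [val i = w i]. *)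
Section Hull.
Variable T : finType.
Implicit Types (pos val : T -> nat) (p : {perm T}).

(** The clauses are 4231, 35142, 42513 and 351624, with the letters named in order of position. *)
Definition avoiding pos val : Prop :=
  [/\ forall a b c d, pos a < pos b < pos c -> pos c < pos d ->
        val d < val b < val c -> val c < val a -> False,
      forall a b c d e, pos a < pos b < pos c -> pos c < pos d < pos e ->
        val c < val e < val a -> val a < val d < val b -> False,
      forall a b c d e, pos a < pos b < pos c -> pos c < pos d < pos e ->
        val d < val b < val e -> val e < val a < val c -> False &
      forall a b c d e f, pos a < pos b < pos c -> pos c < pos d < pos e -> pos e < pos f ->
        val c < val e < val a -> val a < val f < val b -> val b < val d -> False].

(** For [p = u * w^-1] and [val i = w i], the value [val (p i)] is [u i]. *)
Definition in_hull pos val p : Prop := forall i,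
  (exists2 x, pos x <= pos i & val (p i) <= val x) /\
  (exists2 x, pos i <= pos x & val x <= val (p i)).

(** A half-turn fixes 4231 and 351624 and exchanges 35142 with 42513. *)
Lemma avoiding_rev N pos val : (forall i, pos i <= N) -> (forall i, val i <= N) ->
  avoiding pos val -> avoiding (fun i => N - pos i) (fun i => N - val i).
Proof.
move=> posN valN [h1 h2 h3 h4].
have rp i j : (N - pos i < N - pos j) = (pos j < pos i).
  by have := posN i; have := posN j; lia.
have rv i j : (N - val i < N - val j) = (val j < val i).
  by have := valN i; have := valN j; lia.
split=> [a b c d|a b c d e|a b c d e|a b c d e f]; rewrite !rp !rv.
- move=> /andP[? ?] ? /andP[? ?] ?.
  by apply: (h1 d c b a) => //; apply/andP.
- move=> /andP[? ?] /andP[? ?] /andP[? ?] /andP[? ?].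
  by apply: (h3 e d c b a); apply/andP.
- move=> /andP[? ?] /andP[? ?] /andP[? ?] /andP[? ?].
  by apply: (h2 e d c b a); apply/andP.
- move=> /andP[? ?] /andP[? ?] ? /andP[? ?] /andP[? ?] ?.
  by apply: (h4 f e d c b a) => //; apply/andP.
Qed.

Lemma in_hull_rev N pos val p : (forall i, pos i <= N) -> (forall i, val i <= N) ->
  in_hull pos val p -> in_hull (fun i => N - pos i) (fun i => N - val i) p.
Proof.
move=> posN valN hull i; have [[x xi ix] [y yi iy]] := hull i.
by split; [exists y|exists x]; apply: leq_sub2l.
Qed.

(** Otherwise [val] increases with [pos] along a nontrivial cycle. Let [c1] be its leftmost point
    and [c2] the earlier of the image and the preimage of [c1]. The hull condition gives [q] to the
    upper left and [d] to the lower right, and [q], [c1], [c2], [d] form 4231. *)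
Lemma hull_inversion pos val p : injective pos -> injective val ->
  avoiding pos val -> in_hull pos val p -> p != 1%g ->
  exists c d, [/\ c \in porbit p d, pos c < pos d & val d < val c].
Proof.
move=> posI valI [av _ _ _] hull p1.
have [c0 pc0] : exists c0, p c0 != c0.
  apply/existsP; rewrite -negb_forall; apply: contra p1 => /forallP H.
  by apply/eqP/permP => i; rewrite perm1; apply/eqP/H.
apply: contrapT => noinv.
have mono c d : c \in porbit p c0 -> d \in porbit p c0 -> pos c <= pos d -> val c <= val d.
  move=> cC dC cd; rewrite leqNgt; apply/negP => dc; apply: noinv; exists c, d.
  split=> //; first by apply: porbit_trans cC _; rewrite porbit_sym.
  move: cd; rewrite leq_eqVlt => /orP[/eqP/posI E|//].
  by rewrite E ltnn in dc.
have [c1 c1C c1min] := arg_minnP pos (porbit_id p c0).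
have pc1 : p c1 != c1.
  apply: contra pc0 => /eqP E; have : c0 \in porbit p c1 by rewrite porbit_sym.
  by move=> /porbitP[k ->]; rewrite -permM -expgSr expgS permM E.
set y := p c1; pose z := (p^-1)%g c1.
have pz : p z = c1 by rewrite permKV.
have yC : y \in porbit p c0 by rewrite mem_porbit_perm.
have zC : z \in porbit p c0 by rewrite -mem_porbit_perm pz.
have zc1 : z != c1 by apply: contra pc1 => /eqP E; rewrite -{1}E pz.
have neq_pos i j : i != j -> pos i != pos j by apply: contra => /eqP/posI->.
have [c2 [c2C c2y c2z c12]] : exists c2, [/\ c2 \in porbit p c0, pos c2 <= pos y,
    pos c2 <= pos z & c2 != c1].
  by have [|/ltnW] := leqP (pos y) (pos z); [exists y|exists z].
have lt12 : pos c1 < pos c2.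
  by rewrite ltn_neqAle c1min// andbT eq_sym neq_pos.
have v12 : val c1 < val c2.
  by rewrite ltn_neqAle mono 1?ltnW// andbT; apply: contra c12 => /eqP/valI->.
have [[q qc1 yq] _] := hull c1; have [_ [d zd dz]] := hull z.
have v2y : val c2 <= val y by apply: mono.
rewrite pz in dz; rewrite -/y in yq.
clear - posI valI av lt12 v12 qc1 yq zd dz c2z v2y.
have c2q : val c2 <= val q by lia.
have nq : val c2 != val q by apply/eqP => /valI E; rewrite -E in qc1; lia.
have nq1 : pos q != pos c1 by apply/eqP => /posI E; rewrite E in c2q; lia.
have nd : val d != val c1.
  by apply/eqP => /valI E; rewrite E in zd; lia.
have nd2 : pos d != pos c2 by apply/eqP => /posI E; rewrite E in dz; lia.
by apply: (av q c1 c2 d); lia.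
Qed.

Lemma iter_first (q : T -> bool) (f : T -> T) x k : q (iter k f x) ->
  exists j, [/\ j <= k, q (iter j f x) & forall i, i < j -> ~~ q (iter i f x)].
Proof.
move=> qk; have ex : exists j, q (iter j f x) by exists k.
case: (ex_minnP ex) => j qj jmin; exists j; split=> //; first exact: jmin.
by move=> i ij; apply/negP => /jmin; lia.
Qed.

(* If the conclusion fails then [p a] lies before [a], and some [x] strictly
   between [a] and [b] has a value below that of [p a].  Let [b'] be the first
   point of the orbit a, p a, p (p a), ... at or after [b], and [y] the last
   point before this orbit first reaches a value at least
   min (val a) (val b').  The hull condition at [y] provides [r], and [p a],
   [r], [y], [a], [x], [b'] contain one of the four patterns. *)
Lemma hull_swap_low pos val p a b : injective pos -> injective val ->
  avoiding pos val -> in_hull pos val p ->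
  b \in porbit p a -> pos a < pos b -> val b < val a ->
  (forall c, c \in porbit p a -> ~~ (pos a < pos c < pos b)) ->
  exists2 x, pos b <= pos x & val x <= val (p a).
Proof.
move=> posI valI [av1 av2 av3 av4] hull bC ab vab adj.
apply: contrapT => nex.
have above x : pos b <= pos x -> val (p a) < val x.
  by move=> bx; rewrite ltnNge; apply/negP => xa; apply: nex; exists x.
set a' := p a in above nex *.
have neq_pos i j : val i != val j -> pos i != pos j.
  by apply: contra => /eqP/posI->.
have neq_val i j : pos i != pos j -> val i != val j.
  by apply: contra => /eqP/valI->.
have a'b := above b (leqnn _).
have a'C : a' \in porbit p a by rewrite mem_porbit_perm porbit_id.
have left_of c : c \in porbit p a -> pos c < pos b -> c != a -> pos c < pos a.
  move=> cC cb ca; have := adj c cC.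
  have : pos c != pos a by apply: contra ca => /eqP/posI->.
  by lia.
have a'a : pos a' < pos a.
  apply: left_of => //; first by rewrite ltnNge; apply/negP => /above; lia.
  by apply/eqP => E; rewrite E in a'b; lia.
have [_ [x ax xa']] := hull a; rewrite -/a' in xa'.
have xb : pos x < pos b by rewrite ltnNge; apply/negP => /above; lia.
have nxa : pos x != pos a by apply: neq_pos; lia.
have nxa' : val x != val a' by apply: neq_val; lia.
have [k bk] : exists k, pos b <= pos (iter k p a').
  have /porbitP[k bE] : b \in porbit p a'.
    by rewrite porbit_sym mem_porbit_perm porbit_sym.
  by exists k; rewrite -permX -bE.
have {k bk} [k [_ bk kmin]] := @iter_first (fun c => pos b <= pos c) p a' k bk.
set b' := iter k p a' in bk; have a'b' := above b' bk.
have iterC j : iter j p a' \in porbit p a.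
  by elim: j => //= j IHj; rewrite mem_porbit_perm.
pose high c := minn (val a) (val b') <= val c.
have hk : high (iter k p a') by rewrite /high geq_minr.
have [[|j] [jk hj jmin]] := iter_first hk; first by move: hj; rewrite /high /=; lia.
set y := iter j p a'; have := jmin j (leqnn _); rewrite -/y => hy.
have ya : pos y < pos a.
  apply: left_of; first exact: iterC.
    by have := kmin j jk; rewrite -ltnNge.
  by apply/eqP => E; move: hy; rewrite E /high; lia.
have [[r ry yr] _] := hull y.
have hr : high r by apply: leq_trans yr; apply: hj.
have nry : pos r != pos y by apply/eqP => /posI E; move: hy; rewrite -E hr.
have nra : val r != val a by apply: neq_val; lia.
have nrb' : val r != val b' by apply: neq_val; lia.
(* If [r] came before [a'], then [r], [a'], [a], [x] would form 4231, or together with [b'] they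
   would form 42513. *)
have a'r : pos a' < pos r.
  rewrite ltnNge; apply/negP => ra'.
  have nra' : pos r != pos a'.
    by apply/eqP => /posI E; move: hr; rewrite E /high; lia.
  have [ra|ar] := ltnP (val a) (val r); first by apply: (av1 r a' a x); lia.
  by apply: (av3 r a' a x b'); move: hr; rewrite /high; lia.
have nyx : val y != val x by apply: neq_val; lia.
(* The two comparisons decide the pattern: 4231, 35142, 42513 and 351624, in the order of the
   cases. *)
have [ra|ar] := ltnP (val a) (val r); have [xy|yx] := ltnP (val x) (val y);
  move: hr hy; rewrite /high => hr hy.
- by apply: (av1 r y a x); lia.
- by apply: (av2 a' r y a x); lia.
- by apply: (av3 r y a x b'); lia.
- by apply: (av4 a' r y a x b'); lia.
Qed.

(** The image of [hull_swap_low] under the half-turn, which exchanges the roles of [a] and [b]; [N]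
    bounds all labels, so that the truncated subtraction reverses them. *)
Lemma hull_swap_high pos val p a b : injective pos -> injective val ->
  avoiding pos val -> in_hull pos val p ->
  b \in porbit p a -> pos a < pos b -> val b < val a ->
  (forall c, c \in porbit p a -> ~~ (pos a < pos c < pos b)) ->
  exists2 x, pos x <= pos a & val (p b) <= val x.
Proof.
move=> posI valI av hull ba ab vab adj.
pose N := maxn (\max_i pos i) (\max_i val i).
have posN i : pos i <= N by rewrite leq_max leq_bigmax.
have valN i : val i <= N by rewrite leq_max leq_bigmax orbT.
have revI (f : T -> nat) : (forall i, f i <= N) -> injective f -> injective (fun i => N - f i).
  by move=> fN fI i j /= E; apply: fI; have := fN i; have := fN j; lia.
have [x bx xa] : exists2 x, N - pos a <= N - pos x & N - val x <= N - val (p b).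
  apply: (@hull_swap_low (fun i => N - pos i) (fun i => N - val i)) => //.
  - exact: revI.
  - exact: revI.
  - exact: avoiding_rev.
  - exact: in_hull_rev.
  - by rewrite porbit_sym.
  - by have := posN b; lia.
  - by have := valN a; lia.
  - move=> c cC; have := adj c (porbit_trans cC ba).
    by have := posN b; have := posN c; lia.
have := (posN a, posN x, valN x, valN (p b)) => -[[[? ?] ?] ?].
by exists x; lia.
Qed.

(** Only the images of [a] and [b] change. For each of them one half of the condition is inherited
    from the other point, since [a] lies before [b]; the other half is one of the two preceding
    lemmas. *)
Lemma in_hull_swap pos val p a b : injective pos -> injective val ->
  avoiding pos val -> in_hull pos val p ->
  a \in porbit p b -> pos a < pos b -> val b < val a ->
  (forall c, c \in porbit p b -> ~~ (pos a < pos c < pos b)) ->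
  in_hull pos val (tperm a b * p)%g.
Proof.
move=> posI valI av hull ab lt_ab vab adj i.
have ba : b \in porbit p a by rewrite porbit_sym.
have adj' c : c \in porbit p a -> ~~ (pos a < pos c < pos b).
  by move=> cC; apply: adj; apply: porbit_trans cC ab.
rewrite permM; case: tpermP => [->|->|_ _]; last exact: hull.
- split; first exact: hull_swap_high.
  by have [_ [x bx xb]] := hull b; exists x; lia.
- split; last exact: hull_swap_low.
  by have [[x bx xb] _] := hull a; exists x; lia.
Qed.

End Hull.

(** Splitting cycles at the shortest linked inversion stays in the hull; once no inversion is
    linked, [hull_inversion] leaves only the identity. *)
Lemma avoiding_nbc_products n (w u : 'S_n) :
  avoiding (fun i : 'I_n => i : nat) (fun i : 'I_n => w i : nat) ->
  diag u \subset right_hull w -> (u * w^-1)%g \in nbc_products (inversions w).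
Proof.
set pos := fun i : 'I_n => i : nat; set val := fun i : 'I_n => w i : nat => av.
have posI : injective pos by exact: val_inj.
have valI : injective val by move=> i j /val_inj/perm_inj.
move=> /diag_right_hullP hu.
have: in_hull pos val (u * w^-1)%g.
  by move=> i; rewrite /val permM permKV; apply: hu.
move: (u * w^-1)%g => p {u hu}.
pose P E := forall p, in_hull pos val p ->
    (forall f, f \in inversions w -> f \notin E -> ~~ linked p f) ->
    p \in nbc_products E.
suff H : P (inversions w) by move=> hp; apply: H => // f ->.
apply: inversions_ind => {p}.
  move=> p hp unl; rewrite inE; apply: contrapT => /negP p1.
  have [c [d [cd lt_cd vcd]]] := hull_inversion posI valI av hp p1.
  have := unl (c, d); rewrite mem_inversions lt_cd vcd in_nil => /(_ isT isT).
  by rewrite /= cd.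
move=> g E g12 wg short IH p hp unl.
have neq_g : g.1 != g.2 by rewrite -val_eqE neq_ltn g12.
rewrite mem_nbc_products//; case: ifPn => pg; apply: IH => //.
- apply: in_hull_swap => //.
  by apply: (shortest_linked_adjacent wg pg) => f fw /short; apply: unl.
- move=> f fw fE; have [->|fg] := eqVneq f g; first by rewrite porbit_mul_tperm ?pg.
  have := unl f fw; rewrite inE negb_or fg fE => /(_ isT); apply: contra.
  exact: porbit_split.
- move=> f fw fE; have [->//|fg] := eqVneq f g.
  by apply: unl; rewrite // inE negb_or fg.
Qed.

(** * Regions of the inversion arrangement, counted by deletion-contraction *)

Section Regions.
Variables (R : realType) (n : nat).
Local Open Scope ring_scope.
Implicit Types (f : 'I_n -> R) (e : 'I_n * 'I_n) (F : seq ('I_n * 'I_n)) (q w : 'S_n).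

Definition sign_vector F f : seq bool := [seq f e.1 < f e.2 | e <- F].

(** The complement of the contracted arrangement: points of the flat where coordinates agree along
    the cycles of [q], off the hyperplanes of [F]. *)
Definition generic_on F q f : Prop :=
  (forall i, f (q i) = f i) /\ {in F, forall e, f e.1 != f e.2}.

Lemma min_gap F f : {in F, forall e, f e.1 != f e.2} ->
  exists2 eps, 0 < eps & {in F, forall e, eps < `|f e.1 - f e.2|}.
Proof.
elim: F => [_|e F IHF neq]; first by exists 1.
have [|eps eps0 epsF] := IHF.
  by move=> g gF; apply: neq; rewrite inE gF orbT.
have e0 : 0 < `|f e.1 - f e.2| / 2.
  by rewrite divr_gt0// normr_gt0 subr_eq0 neq// mem_head.
exists (Num.min eps (`|f e.1 - f e.2| / 2)); first by rewrite lt_min eps0.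
move=> g; rewrite inE => /orP[/eqP->|/epsF]; rewrite gt_min.
  by apply/orP; right; lra.
by move=> ->.
Qed.

(** Shifting the coordinates on the cycle of [e.1] by less than every gap moves the point to either
    side of the hyperplane of [e] without changing the other signs. *)
Lemma generic_on_perturb e F q f (b : bool) : e.1 != e.2 -> e.1 \notin porbit q e.2 ->
  generic_on F (tperm e.1 e.2 * q)%g f ->
  exists2 g, generic_on (e :: F) q g & sign_vector (e :: F) g = b :: sign_vector F f.
Proof.
move=> e12 qe [finv fF].
have fe : f e.1 = f e.2.
  by apply: (porbit_invariant finv); rewrite porbit_mul_tperm.
have fq i : f (q i) = f i.
  by apply: (porbit_invariant finv); apply: porbit_join; rewrite ?mem_porbit_perm ?porbit_id.
have [eps eps0 epsF] := min_gap fF.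
pose g i := f i + (-1) ^+ b * (if i \in porbit q e.1 then eps else 0).
have gF h : h \in F -> (g h.1 < g h.2) = (f h.1 < f h.2) /\ g h.1 != g h.2.
  move=> hF; have := epsF _ hF; rewrite /g.
  case: ifP => _; case: ifP => _; case: b {g} => /=; rewrite ?expr1 ?expr0;
  case: (ltrgtP (f h.1) (f h.2)) (fF _ hF) => // lt_f _ epsh; split;
  try (by apply/idP; lra); try (by apply/negbTE; rewrite -leNgt; lra);
  try (by rewrite lt_eqF//; lra); by rewrite gt_eqF//; lra.
have ge : (g e.1 < g e.2) = b /\ g e.1 != g e.2.
  rewrite /g porbit_id porbit_sym (negPf qe) mulr0 addr0 fe.
  case: b {g gF} => /=; rewrite ?expr1 ?expr0; split.
  - by apply/idP; lra.
  - by rewrite lt_eqF//; lra.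
  - by apply/negbTE; rewrite -leNgt; lra.
  - by rewrite gt_eqF//; lra.
exists g.
  split=> [i|h]; first by rewrite /g fq mem_porbit_perm.
  by rewrite inE => /orP[/eqP->|/gF[]] //; case: ge.
rewrite /sign_vector /= ge.1; congr cons.
by apply/eq_in_map => h /gF[].
Qed.

(* A positive combination of two points on opposite sides of a hyperplane lies
   on it. *)
Lemma generic_on_restrict e F q f1 f2 :
  generic_on (e :: F) q f1 -> generic_on (e :: F) q f2 ->
  f1 e.1 < f1 e.2 -> f2 e.2 < f2 e.1 -> sign_vector F f1 = sign_vector F f2 ->
  exists2 g, generic_on F (tperm e.1 e.2 * q)%g g & sign_vector F g = sign_vector F f1.
Proof.
move=> [inv1 gen1] [inv2 gen2] lt1 lt2 /eq_in_map sgn.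
pose g i := (f2 e.1 - f2 e.2) * f1 i + (f1 e.2 - f1 e.1) * f2 i.
have gF h : h \in F -> (g h.1 < g h.2) = (f1 h.1 < f1 h.2) /\ g h.1 != g h.2.
  move=> hF; have hF' : h \in e :: F by rewrite inE hF orbT.
  have := sgn h hF; case: (ltrgtP (f1 h.1) (f1 h.2)) (gen1 _ hF') => // l1 _;
  case: (ltrgtP (f2 h.1) (f2 h.2)) (gen2 _ hF') => // l2 _ _.
    have lt_g : g h.1 < g h.2 by rewrite /g; nra.
    by rewrite lt_g lt_eqF.
  have lt_g : g h.2 < g h.1 by rewrite /g; nra.
  by rewrite ltNge (ltW lt_g) gt_eqF.
exists g; last by apply/eq_in_map => h /gF[].
split=> [i|h /gF[]//]; rewrite permM.
have ge : g e.1 = g e.2 by rewrite /g; ring.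
have -> : g (q (tperm e.1 e.2 i)) = g (tperm e.1 e.2 i) by rewrite /g inv1 inv2.
by case: tpermP => [->|->|].
Qed.

(** A sign vector of the deletion extends to both sides of the hyperplane of [e] exactly when it
    occurs on that hyperplane, that is, in the contraction. If [e] is a loop, no point is
    generic. *)
Lemma sign_vectors_nbc F q : all (fun e => e.1 != e.2) F ->
  exists L, [/\ uniq L, size L = size (nbc F q) &
    forall s, s \in L <-> exists2 f, generic_on F q f & sign_vector F f = s].
Proof.
elim: F q => [|e F IHF] q /=.
  move=> _; exists [:: [::]]; split=> // s; rewrite inE; split=> [/eqP->|[f _ <-]//].
  by exists (fun=> 0).
move=> /andP[e12 /IHF{}IHF]; case: ifPn => qe.
  exists [::]; split=> // s; split=> // -[f [fq neq] _].
  have := neq e; rewrite mem_head => /(_ isT)/negP[]; apply/eqP.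
  exact: porbit_invariant qe.
have [L1 [uL1 sL1 memL1]] := IHF q.
have [L2 [uL2 sL2 memL2]] := IHF (tperm e.1 e.2 * q)%g.
pose pos s := exists2 f, generic_on (e :: F) q f & sign_vector (e :: F) f = true :: s.
pose hd s := `[< pos s >].
(* Every vector of the deletion receives one realizable sign [hd s], and those of the contraction
   also receive the opposite sign. *)
exists ([seq hd s :: s | s <- L1] ++ [seq ~~ hd s :: s | s <- L2]).
have inj_cons (h : seq bool -> bool) : injective (fun s => h s :: s) by move=> s t [].
split.
- rewrite cat_uniq !map_inj_uniq// uL1 uL2 andbT /=; apply/hasPn => _ /mapP[s _ ->].
  by apply/mapP => -[t _ [+ st]]; rewrite st; case: (hd t).
- by rewrite !size_cat !size_map sL1 sL2.
move=> t; rewrite mem_cat; split.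
  move=> /orP[/mapP[s /memL1[f [fq fF] fs] ->]|/mapP[s /memL2[f fF <-] ->]]; last first.
    exact: generic_on_perturb.
  have [/asboolP//|nhd] := boolP (hd s).
  have [fe|fe] := eqVneq (f e.1) (f e.2).
    have fF' : generic_on F (tperm e.1 e.2 * q)%g f.
      by split=> // i; rewrite permM fq; case: tpermP => [->|->|].
    rewrite -fs; exact: (generic_on_perturb false e12 qe fF').
  have gf : generic_on (e :: F) q f.
    by split=> // h; rewrite inE => /orP[/eqP->//|/fF].
  exists f => //; rewrite /sign_vector /= -/(sign_vector F f) fs; congr cons.
  apply/negbTE; apply: contra nhd => lt_f; apply/asboolP; exists f => //.
  by rewrite /sign_vector /= -/(sign_vector F f) fs lt_f.
move=> [f fF <-]; rewrite /sign_vector /= -/(sign_vector F f).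
set s := sign_vector F f.
have fF' : generic_on F q f.
  by case: fF => fq fF; split=> // h hF; apply: fF; rewrite inE hF orbT.
have sL : s \in L1 by apply/memL1; exists f.
have [->|neq] := eqVneq (f e.1 < f e.2) (hd s).
  by apply/orP; left; apply/mapP; exists s.
apply/orP; right; apply/mapP; exists s; last first.
  by move: neq; case: (_ < _); case: (hd s).
have lt_f : f e.2 < f e.1.
  case: (ltgtP (f e.1) (f e.2)) => // [lt_f|eq_f].
    move: neq; rewrite lt_f eq_sym eqb_id => /asboolP[]; exists f => //.
    by rewrite /sign_vector /= lt_f.
  by have := fF.2 e; rewrite mem_head eq_f eqxx => /(_ isT).
move: neq; rewrite ltNge (ltW lt_f) eq_sym eqbF_neg negbK => /asboolP[g gF].
rewrite /sign_vector /= => -[g_e gs]; apply/memL2.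
by have [h hF hs] := generic_on_restrict gF fF g_e lt_f gs; exists h; rewrite // hs.
Qed.

Lemma segment_lt (a b c d t : R) : 0 <= t -> t <= 1 -> a < b -> c < d ->
  a + t * (c - a) < b + t * (d - b).
Proof.
move=> t0 t1 ab cd; have [->|tn0] := eqVneq t 0; first by lra.
have h1 : 0 < t * (d - c) by rewrite mulr_gt0 ?subr_gt0// lt_neqAle eq_sym tn0.
have h2 : 0 <= (1 - t) * (b - a) by rewrite mulr_ge0 ?subr_ge0// ltW.
by lra.
Qed.

Local Open Scope classical_set_scope.

Definition coords (x : 'rV[R]_n) : 'I_n -> R := x ord0.

Lemma arrangement_complementP w x : arrangement_complement R w x <->
  generic_on (rev (inversions w)) 1%g (coords x).
Proof.
split=> [H|[_ H] [p [p12 wp] /= E]].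
  split=> [i|e]; first by rewrite perm1.
  rewrite mem_rev mem_inversions => /andP[e12 we]; apply/eqP => E.
  by apply: H; exists e.
have := H p; rewrite mem_rev mem_inversions p12 wp => /(_ isT) /eqP; exact.
Qed.

Definition region w (s : seq bool) : set 'rV[R]_n :=
  [set y | arrangement_complement R w y /\
           sign_vector (rev (inversions w)) (coords y) = s].

(** Points with equal signs are joined by a segment inside the complement. Conversely, a coordinate
    difference that vanishes nowhere on a connected set keeps its sign there. *)
Lemma connected_component_region w x : arrangement_complement R w x ->
  connected_component (arrangement_complement R w) x
  = region w (sign_vector (rev (inversions w)) (coords x)).
Proof.
set F := rev (inversions w) => cx; apply/seteqP; split=> y; last first.
  move=> [cy sy].
  have seg : continuous (fun t : R => x + t *: (y - x)).
    move=> t; apply: cvgD; first exact: cvg_cst.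
    by apply: cvgZr_tmp; apply: cvg_id.
  pose S := [set x + t *: (y - x) | t in `[0, 1]].
  apply: (@connected_component_max _ _ S).
  - by exists 0; rewrite ?scale0r ?addr0//= in_itv /= lexx ler01.
  - move=> z [t /=]; rewrite in_itv /= => /andP[t0 t1] <- {z}.
    apply/arrangement_complementP; split=> [i|e eF]; first by rewrite perm1.
    have /arrangement_complementP[_ /(_ e eF)] := cx.
    have /arrangement_complementP[_ /(_ e eF)] := cy.
    have /eq_in_map/(_ e eF) := sy; rewrite /coords !mxE.
    case: (ltrgtP (x ord0 e.1)) => // lx; case: (ltrgtP (y ord0 e.1)) => // ly _ _ _.
      by rewrite lt_eqF// segment_lt.
    by rewrite gt_eqF// segment_lt.
  - apply: connected_continuous_connected; first exact: segment_connected.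
    exact: continuous_subspaceT.
  - exists 1; last by rewrite scale1r addrC subrK.
    by rewrite /= in_itv /= lexx ler01.
move=> [B [Bx BA cB] By]; split; first exact: BA.
apply/eq_in_map => e eF; pose d (z : 'rV[R]_n) := z ord0 e.2 - z ord0 e.1.
have dC : continuous d.
  move=> z; have cj j := @coord_continuous R 1 n ord0 j z.
  exact: cvgB (cj _) (cj _).
have /connected_intervalP itv : connected (d @` B).
  by apply: connected_continuous_connected => //; apply: continuous_subspaceT.
have d0 : ~ (d @` B) 0.
  move=> [z /BA/arrangement_complementP[_ /(_ e eF)] + /eqP].
  by rewrite subr_eq0 eq_sym => /negP.
have dx : (d @` B) (d x) by exists x.
have dy : (d @` B) (d y) by exists y.
rewrite /coords -[LHS]subr_gt0 -[RHS]subr_gt0 -/(d x) -/(d y).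
have [ly|ly] := ltrP 0 (d y); have [lx|lx] := ltrP 0 (d x) => //.
  by case: d0; apply: (itv _ _ dx dy); rewrite lx ltW.
by case: d0; apply: (itv _ _ dy dx); rewrite ly ltW.
Qed.

Lemma card_reg w : (reg R w #= `I_(size (nbc_products (inversions w))))%card.
Proof.
set F := rev (inversions w).
have [|L [uL sL memL]] := @sign_vectors_nbc F 1%g.
  by rewrite all_rev inversions_neq.
have -> : size (nbc_products (inversions w)) = size L by rewrite sL.
have -> : reg R w = [set region w (nth [::] L k) | k in `I_(size L)].
  apply/seteqP; split=> [_ [x cx <-]|_ [k /= kL <-]].
    rewrite connected_component_region// -/F; set s := sign_vector _ _.
    have sL' : s \in L by apply/memL; exists (coords x) => //; apply/arrangement_complementP.
    by exists (index s L); rewrite /= ?index_mem// nth_index.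
  have /memL[f fF fs] := mem_nth [::] kL.
  pose x : 'rV[R]_n := \row_i f i.
  have xE : coords x = f by apply/funext => i; rewrite /coords mxE.
  have cx : arrangement_complement R w x by apply/arrangement_complementP; rewrite xE.
  by exists x; rewrite // connected_component_region// xE fs.
apply: inj_card_eq => j k; rewrite !inE /= => jL kL E.
have /memL[f fF fs] := mem_nth [::] jL.
pose x : 'rV[R]_n := \row_i f i.
have xE : coords x = f by apply/funext => i; rewrite /coords mxE.
have : region w (nth [::] L j) x.
  by split; [apply/arrangement_complementP; rewrite xE|rewrite xE].
rewrite E => -[_]; rewrite xE fs => /eqP.
by rewrite nth_uniq// => /eqP.
Qed.

Lemma card_finset (T : finType) (A : {set T}) : ([set` A] #= `I_#|A|)%card.
Proof.
have -> : [set` A] = [set enum_val k | k in [set: 'I_#|A|]].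
  apply/seteqP; split=> [x /= xA|_ [k _ <-]]; last exact: enum_valP.
  by exists (enum_rank_in xA x) => //; rewrite enum_rankK_in.
apply: (card_eq_trans (inj_card_eq _)); last by rewrite card_eq_sym card_II.
by move=> j k _ _; apply: enum_val_inj.
Qed.

End Regions.

(** * Obstructions carried by the four patterns *)

Section Patterns.
Variable n : nat.
Implicit Types (u v w x : 'S_n) (f : nat -> 'I_n) (l : seq (nat * nat)).

(** Natural indices turn conditions on the pattern into computations on lists; [f] is unconstrained
    from [m] on. *)
Definition occurs (m : nat) (s : seq nat) w f : Prop :=
  (forall i j, i < j -> j < m -> f i < f j) /\
  (forall i j, i < m -> j < m -> nth 0 s i < nth 0 s j -> w (f i) < w (f j)).

Lemma contains_one_lineP m s (sP : perm_eq s (iota 1 m.+1)) w :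
  contains_pattern w (one_line sP) <-> exists f, occurs m.+1 s w f.
Proof.
have pE (j k : 'I_m.+1) : (one_line sP j < one_line sP k) = (nth 0 s j < nth 0 s k).
  by rewrite -ltnS !one_lineE.
split=> [[f [fmono fw]]|[f [fmono fw]]].
  exists (fun k => f (inord k)); split=> [i j ij jm|i j im jm sij].
    by apply: fmono; rewrite !inordK// (ltn_trans ij).
  have := pE (inord i) (inord j); rewrite !inordK// sij.
  have [ij|ji|E] := ltngtP i j.
  - by move=> pij; apply/fw; rewrite // !inordK.
  - move=> pij; have lt_ji : (inord j : 'I_m.+1) < (inord i : 'I_m.+1) by rewrite !inordK.
    rewrite ltn_neqAle leqNgt; apply/andP; split; last first.
      by apply/negP => /(fw _ _ lt_ji); move: pij; lia.
    apply/eqP => /val_inj/perm_inj E; have := fmono _ _ lt_ji.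
    by rewrite E ltnn.
  - by move: sij; rewrite E ltnn.
exists (fun k => f k); split=> [j k jk|j k jk]; first exact: fmono.
rewrite pE; split; first exact: fw.
move=> wjk; rewrite ltn_neqAle leqNgt; apply/andP; split; last first.
  by apply/negP => /fw; move/(_ (ltn_ord _) (ltn_ord _)); lia.
have us : uniq s by rewrite (perm_uniq sP) iota_uniq.
by rewrite nth_uniq ?(perm_size sP) ?size_iota// neq_ltn jk.
Qed.

Definition swap_index (e : nat * nat) k :=
  if k == e.1 then e.2 else if k == e.2 then e.1 else k.

Definition swap_indices l k := foldl (fun k e => swap_index e k) k l.

Definition swap_positions f l w : 'S_n :=
  foldr (fun e x => tperm (f e.1) (f e.2) * x)%g w l.

(* The swaps in [l], read from right to left, lead down in Bruhat order. *)
Fixpoint descending m (s : seq nat) l : bool :=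
  if l is e :: l' then
    [&& e.1 < e.2, e.2 < m, nth 0 s (swap_indices l' e.2) < nth 0 s (swap_indices l' e.1)
      & descending m s l']
  else true.

Lemma swap_indices_lt m l k : all (fun e => (e.1 < m) && (e.2 < m)) l ->
  k < m -> swap_indices l k < m.
Proof.
elim: l k => //= e l IHl k /andP[/andP[e1 e2] lm] km; apply: IHl => //.
by rewrite /swap_index; case: ifP => // _; case: ifP.
Qed.

Lemma swap_positionsE m s w f l k : occurs m s w f ->
  all (fun e => (e.1 < m) && (e.2 < m)) l -> k < m ->
  swap_positions f l w (f k) = w (f (swap_indices l k)).
Proof.
move=> [fmono _]; have fI i j : i < m -> j < m -> f i = f j -> i = j.
  move=> im jm E; have [ij|ji|//] := ltngtP i j.
    by have := fmono _ _ ij jm; rewrite E ltnn.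
  by have := fmono _ _ ji im; rewrite E ltnn.
elim: l k => [|e l IHl] k //= /andP[/andP[e1 e2] lm] km; rewrite permM /swap_index.
have [->|k1] := eqVneq k e.1; first by rewrite tpermL IHl.
have [->|k2] := eqVneq k e.2; first by rewrite tpermR IHl.
rewrite tpermD ?IHl//; first by apply: contra k1 => /eqP/fI->.
by apply: contra k2 => /eqP/fI->.
Qed.

Lemma swap_positions_off w f l (x : 'I_n) :
  all (fun e => (f e.1 != x) && (f e.2 != x)) l -> swap_positions f l w x = w x.
Proof.
elim: l => //= e l IHl /andP[/andP[e1 e2] /IHl{}IHl].
by rewrite permM tpermD.
Qed.

Lemma descending_bounds m s l :
  descending m s l -> all (fun e => (e.1 < m) && (e.2 < m)) l.
Proof. by elim: l => //= e l IHl /and4P[e12 e2 _ /IHl->]; rewrite e2 (ltn_trans e12). Qed.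

Lemma descending_bruhat_le m s w f l : occurs m s w f -> descending m s l ->
  bruhat_le (swap_positions f l w) w.
Proof.
move=> occ; have [fmono fw] := occ; elim: l => [|e l IHl] /=.
  by move=> _; apply: connect0.
move=> /and4P[e12 e2 se dl]; apply: connect_trans (IHl dl); apply: connect1.
have lm := descending_bounds dl; have e1 := ltn_trans e12 e2.
apply/bruhat_edgeP; exists (f e.1), (f e.2); split; first exact: fmono.
  rewrite !permM tpermL tpermR !(swap_positionsE occ lm)//.
  by apply: fw; rewrite ?swap_indices_lt.
by rewrite mulgA tperm2 mul1g.
Qed.

(** A path this short lowers the absolute length at every edge, so each transposition splits a cycle
    and hence preserves [C]. *)
Lemma cycle_path_rank (C : {set 'I_n}) (P Q : pred 'I_n) x w (s : seq 'S_n) :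
  (forall c d : 'I_n, c < d -> P d -> P c) -> (forall c d : 'I_n, c < d -> Q c -> Q d) ->
  path (@bruhat_edge n) x s -> last x s = w -> size s = absolute_length (x * w^-1)%g ->
  (forall i, ((x * w^-1)%g i \in C) = (i \in C)) ->
  rank_in C P Q x <= rank_in C P Q w.
Proof.
move=> hP hQ; elim: s x => [|y s IHs] x /=; first by move=> _ ->.
move=> /andP[/bruhat_edgeP[c [d [cd xcd yE]]] ys sw sz stab].
have neq_cd : c != d by rewrite -val_eqE neq_ltn cd.
have le_y := absolute_length_path ys sw.
have yw : (y * w^-1 = tperm c d * (x * w^-1))%g by rewrite yE mulgA.
have lcd : c \in porbit (x * w^-1)%g d.
  apply: contraT => ncd; move: le_y; rewrite yw absolute_length_join// -sz.
  by rewrite ltnNge leqnSn.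
have cdC : (c \in C) = (d \in C).
  exact: (@porbit_invariant _ _ (fun i => i \in C) _ stab).
apply: (@leq_trans (rank_in C P Q y)).
  by rewrite yE; apply: rank_in_tperm => //; [apply: hP|apply: hQ].
apply: IHs => //.
  by apply: succn_inj; rewrite sz yw absolute_length_split.
by move=> i; rewrite yw permM stab; case: tpermP => [->|->|].
Qed.

(* [K] lists the pattern indices of a cycle, [lv] the swaps realizing that
   cycle, and [lu] a descending sequence of swaps realizing the same cycle on
   [K]; the quadrant with corner at position [i0] refutes comparability with [w]
   already within [K]. *)
Definition witness m (s : seq nat) lu lv (K : seq nat) i0 : bool :=
  let sv k := swap_indices lv k in
  [&& descending m s lu, all (fun e => (e.1 \in K) && (e.2 \in K)) lv,
      all (fun k => k < m) K,
      all (fun k => (swap_indices lu k == sv k) && (sv k \in K)) K,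
      all (fun k =>
        has (fun y => (y <= k) && ((y == sv k) || (nth 0 s (sv k) < nth 0 s y))) (iota 0 m)
     && has (fun y => (k <= y) && ((y == sv k) || (nth 0 s y < nth 0 s (sv k)))) (iota 0 m)) K,
      i0 \in K & all (fun k => (k <= i0) ==> (nth 0 s k < nth 0 s (sv i0))) K].

(** The permutation [v] lies in the hull but not below [w]. The permutation [u] lies below [w] and
    agrees with [v] on [C], where a path of length [absolute_length] would make the restricted rank
    monotone. *)
Lemma witness_obstruction m s w f lu lv K i0 :
  occurs m s w f -> witness m s lu lv K i0 ->
  ~ right_hull_property w /\
  ~ (forall u, bruhat_le u w -> al u w = absolute_length (u * w^-1)%g).
Proof.
move=> occ /and5P[dlu /allP lvK /allP Km /allP uv /and3P[/allP hullK i0K /allP cut]].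
have [fmono fw] := occ.
set u := swap_positions f lu w; set v := swap_positions f lv w.
pose C := [set x : 'I_n | has (fun k => f k == x) K].
have CP (x : 'I_n) : reflect (exists2 k, k \in K & x = f k) (x \in C).
  by rewrite inE; apply: (iffP hasP) => -[k kK]; [move/eqP<-|move->]; exists k.
have lv_m : all (fun e => (e.1 < m) && (e.2 < m)) lv.
  by apply/allP => e /lvK/andP[/Km-> /Km->].
have uE k : k \in K -> u (f k) = w (f (swap_indices lv k)).
  move=> kK; rewrite (swap_positionsE occ (descending_bounds dlu)) ?Km//.
  by have /andP[/eqP-> _] := uv k kK.
have vE k : k \in K -> v (f k) = w (f (swap_indices lv k)).
  by move=> kK; rewrite (swap_positionsE occ lv_m) ?Km.
have v_off (x : 'I_n) : x \notin C -> v x = w x.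
  move=> xC; apply: swap_positions_off; apply/allP => e /lvK/andP[e1 e2].
  by apply/andP; split; apply: contra xC => /eqP E; apply/CP; [exists e.1|exists e.2].
pose P (i : 'I_n) := i <= f i0; pose Q (j : 'I_n) := v (f i0) <= j.
have hP (c d : 'I_n) : c < d -> P d -> P c by rewrite /P; lia.
have hQ (c d : 'I_n) : c < d -> Q c -> Q d by rewrite /Q; lia.
have w_off (x : 'I_n) : x \in C -> P x -> ~~ Q (w x).
  move=> /CP[k kK ->]; rewrite /P /Q -ltnNge vE// => kf.
  have ki0 : k <= i0.
    by rewrite leqNgt; apply/negP => lt_k; have := fmono _ _ lt_k (Km _ kK); lia.
  apply: fw; rewrite ?swap_indices_lt ?Km//.
  by have := cut k kK; rewrite ki0.
have fC : f i0 \in C by apply/CP; exists i0.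
have v_in : P (f i0) && Q (v (f i0)) by rewrite /P /Q !leqnn.
split.
- move=> rh; have le_v : bruhat_le v w.
    suff : v \in lower_interval w by rewrite inE.
    rewrite rh inE; apply/diag_right_hullP => x.
    have [/CP[k kK ->]|xC] := boolP (x \in C); last first.
      by rewrite v_off//; split; exists x.
    rewrite vE//; have km := Km _ kK; have svm := swap_indices_lt lv_m km.
    have /andP[/hasP[y + /andP[yk sy]] /hasP[z + /andP[kz sz]]] := hullK _ kK.
    rewrite !mem_iota !add0n !leq0n /= => ym zm; split.
      exists (f y).
        by move: yk; rewrite leq_eqVlt => /orP[/eqP->//|yk]; rewrite ltnW ?fmono.
      by move: sy => /orP[/eqP->//|sy]; rewrite ltnW ?fw.
    exists (f z).
      by move: kz; rewrite leq_eqVlt => /orP[/eqP->//|kz]; rewrite ltnW ?fmono.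
    by move: sz => /orP[/eqP->//|sz]; rewrite ltnW ?fw.
  have := bruhat_le_rank hP hQ le_v; apply/negP; rewrite -ltnNge /rank_in.
  rewrite (bigD1 (f i0)) ?inE//= [ltnRHS](bigD1 (f i0)) ?inE//=.
  rewrite v_in (negPf (w_off _ fC _)) ?andbF ?add0n ?add1n ?ltnS; last by rewrite /P.
  (* Off [C] the permutations [v] and [w] agree; on [C] no point of [w] lies in the quadrant. *)
  apply: leq_sum => x _; have [xC|xC] := boolP (x \in C); last by rewrite v_off.
  by case Px: (P x) => //=; rewrite (negPf (w_off _ xC Px)).
- move=> al_u; have le_u := descending_bruhat_le occ dlu.
  have [s' [sz us' lu_w]] := directed_distance_path le_u.
  rewrite -/(al _ _) al_u// in sz.
  have stab i : ((u * w^-1)%g i \in C) = (i \in C).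
    have sub : [set (u * w^-1)%g x | x in C] = C.
      apply/eqP; rewrite eqEcard card_imset ?leqnn ?andbT; last exact: perm_inj.
      apply/fintype.subsetP => _ /imsetP[_ /CP[k kK ->] ->].
      rewrite permM uE// permK; apply/CP; exists (swap_indices lv k) => //.
      by have /andP[] := uv k kK.
    by rewrite -{1}sub mem_imset//; apply: perm_inj.
  have := cycle_path_rank hP hQ us' lu_w sz stab.
  have /eqP-> : rank_in C P Q w == 0.
    rewrite -leqn0 leqNgt; apply/rank_in_gt0P => -[x [xC Px]].
    by apply/negP/w_off.
  rewrite leqNgt => /negP; apply; apply/rank_in_gt0P; exists (f i0).
  by rewrite uE// -vE//; move/andP: v_in => [].
Qed.

(** Each row lists the pattern, [lu], [lv], [K] and [i0]. Two indices are missing from [K]; they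
    carry an inversion, and [lu] exchanges them besides realizing the cycle on [K]. *)
Definition pattern_witnesses :
    seq (seq nat * (seq (nat * nat) * seq (nat * nat) * seq nat * nat)) :=
 [:: ([:: 4; 2; 3; 1], ([:: (2, 3); (1, 2); (0, 3); (0, 1)], [:: (1, 2)], [:: 1; 2], 1));
     ([:: 3; 5; 1; 4; 2], ([:: (3, 4); (2, 3); (1, 4); (1, 2); (0, 2)],
        [:: (0, 2); (0, 3)], [:: 0; 2; 3], 2));
     ([:: 4; 2; 5; 1; 3], ([:: (3, 4); (2, 3); (1, 4); (0, 3); (0, 1)],
        [:: (1, 4); (1, 2)], [:: 1; 2; 4], 1));
     ([:: 3; 5; 1; 6; 2; 4], ([:: (4, 5); (3, 4); (2, 5); (1, 4); (1, 2); (0, 2)],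
        [:: (0, 2); (0, 5); (0, 3)], [:: 0; 2; 3; 5], 2))].

Lemma pattern_obstruction m s (sP : perm_eq s (iota 1 m.+1)) w :
  s \in [seq r.1 | r <- pattern_witnesses] -> contains_pattern w (one_line sP) ->
  ~ right_hull_property w /\
  ~ (forall u, bruhat_le u w -> al u w = absolute_length (u * w^-1)%g).
Proof.
move=> /mapP[[r [[[lu lv] K] i0]] rin /= sE] /contains_one_lineP[f occ].
apply: (witness_obstruction occ (lu := lu) (lv := lv) (K := K) (i0 := i0)).
have -> : m.+1 = size r by rewrite -sE (perm_size sP) size_iota.
rewrite sE.
have : all (fun r => let: (s, (lu, lv, K, i0)) := r in witness (size s) s lu lv K i0)
           pattern_witnesses by [].
by move/allP/(_ _ rin).
Qed.

Lemma avoids_avoiding w :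
  avoids_pattern w p4231 -> avoids_pattern w p35142 ->
  avoids_pattern w p42513 -> avoids_pattern w p351624 ->
  avoiding (fun i : 'I_n => i : nat) (fun i : 'I_n => w i : nat).
Proof.
move=> h1 h2 h3 h4; split.
- move=> a b c d pab pcd vab vcd; apply: h1; apply/contains_one_lineP.
  exists (nth a [:: a; b; c; d]).
  by split=> [[|[|[|[|i]]]] [|[|[|[|j]]]]|[|[|[|[|i]]]] [|[|[|[|j]]]]] //=; lia.
- move=> a b c d e pab pcd vab vcd; apply: h2; apply/contains_one_lineP.
  exists (nth a [:: a; b; c; d; e]).
  by split=> [[|[|[|[|[|i]]]]] [|[|[|[|[|j]]]]]|[|[|[|[|[|i]]]]] [|[|[|[|[|j]]]]]] //=; lia.
- move=> a b c d e pab pcd vab vcd; apply: h3; apply/contains_one_lineP.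
  exists (nth a [:: a; b; c; d; e]).
  by split=> [[|[|[|[|[|i]]]]] [|[|[|[|[|j]]]]]|[|[|[|[|[|i]]]]] [|[|[|[|[|j]]]]]] //=; lia.
- move=> a b c d e f pab pcd pef vab vcd vef; apply: h4; apply/contains_one_lineP.
  exists (nth a [:: a; b; c; d; e; f]).
  by split=> [[|[|[|[|[|[|i]]]]]] [|[|[|[|[|[|j]]]]]]|[|[|[|[|[|[|i]]]]]] [|[|[|[|[|[|j]]]]]]]
    //=; lia.
Qed.

End Patterns.

(** * Equivalence of the four conditions *)

Theorem theorem4p5 (R : realType) (n : nat) (w : 'S_n) :
  [<-> (reg R w #= [set` lower_interval w])%card;
       right_hull_property w;
       [/\ avoids_pattern w p4231, avoids_pattern w p35142,
           avoids_pattern w p42513 & avoids_pattern w p351624];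
       forall u : 'S_n, bruhat_le u w -> al u w = absolute_length (u * w^-1)%g].
Proof.
set av := [/\ _, _, _ & _]; set al_eq := forall u, _.
pose D := nbc_products (inversions w).
have uD : uniq D by apply: uniq_nbc_products; apply: inversions_neq.
pose Dw := [set (p * w)%g | p in D].
have cardDw : #|Dw| = size D.
  by rewrite card_imset ?(card_uniqP uD)//; apply: mulIg.
have DwP u : (u \in Dw) = ((u * w^-1)%g \in D).
  apply/imsetP/idP => [[p pD ->]|uD']; first by rewrite mulgK.
  by exists (u * w^-1)%g; rewrite ?mulgKV.
have Dw_sub : Dw \subset lower_interval w.
  by apply/fintype.subsetP => _ /imsetP[p pD ->]; rewrite inE; case: (nbc_products_al pD).
have regP : (reg R w #= [set` lower_interval w])%card <-> #|lower_interval w| = #|Dw|.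
  rewrite cardDw; split=> [reg_eq|E].
    apply/esym/card_eq_II; rewrite -/D.
    apply: card_eq_trans (card_finset _).
    by apply: card_eq_trans reg_eq; rewrite card_eq_sym; apply: card_reg.
  apply: (card_eq_trans (card_reg R w)); rewrite card_eq_sym -/D -E.
  exact: card_finset.
have al_of_Dw : lower_interval w = Dw -> al_eq.
  move=> E u le_u; have : u \in Dw by rewrite -E inE.
  by move=> /imsetP[p pD ->]; rewrite mulgK; case: (nbc_products_al pD).
(* Avoidance closes the chain of inclusions from [Dw] through the interval and the hull back to
   [Dw]. *)
have av_Dw : av -> lower_interval w = Dw /\ right_hull_property w.
  move=> [h1 h2 h3 h4]; have av' := avoids_avoiding h1 h2 h3 h4.
  have hull_sub : [set u : 'S_n | diag u \subset right_hull w] \subset Dw.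
    apply/fintype.subsetP => u; rewrite inE DwP; exact: avoiding_nbc_products.
  have sub_hull : lower_interval w \subset [set u : 'S_n | diag u \subset right_hull w].
    by apply/fintype.subsetP => u; rewrite !inE; apply: bruhat_le_hull.
  split; apply/eqP; rewrite finset.eqEsubset.
    by rewrite Dw_sub (fintype.subset_trans sub_hull).
  by rewrite sub_hull (fintype.subset_trans hull_sub).
have obstr : right_hull_property w \/ al_eq -> av.
  have obstr s m (sP : perm_eq s (iota 1 m.+1)) :
      s \in [seq r.1 | r <- pattern_witnesses] ->
      right_hull_property w \/ al_eq -> avoids_pattern w (one_line sP).
    move=> sin hyp /(pattern_obstruction sin)[nrh nal].
    by case: hyp.
  by move=> hyp; split; apply: obstr.
tfae.
(* Equal cardinality turns the inclusion of [Dw] in the interval into an equality; this gives the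
   distance formula, then avoidance, then the hull property. *)
- move/regP => E; apply: (av_Dw (obstr (or_intror _))).2; apply: al_of_Dw.
  by apply/esym/eqP; rewrite eqEcard Dw_sub E leqnn.
- by move=> rh; apply: obstr; left.
- by move=> /av_Dw[/al_of_Dw].
- by move=> ale; apply/regP; have [-> _] := av_Dw (obstr (or_intror ale)).
Qed.
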